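(* Let $k,r\ge 1$ and $0\le\ell\le k-1$ be integers, $p\in(0,1)$, $q=1-p$. Let $Y$ have the negative binomial distribution $\mathrm{NB}(k,r,\ell)$ with $\ell$-overlapping, let $\lambda_0,\dots,\lambda_{k-1}$ be the roots of the auxiliary polynomial $z^k-qz^{k-1}-qpz^{k-2}-\dots-qp^{k-1}$, and let $a_{jm}$ ($0\le j\le k-1$, $1\le m\le r$) be the coefficients for which $$\mathbb{P}(Y=n)=\sum_{j=0}^{k-1}\sum_{m=1}^r\binom{n-1}{m-1}a_{jm}\lambda_j^{\,n-m}\qquad(n\ge 1).$$ Then for every integer $i\ge 1$ the $i$-th factorial moment $\mathscr{M}_{(i)}=\mathbb{E}[Y(Y-1)\cdots(Y-i+1)]$ is $$\mathscr{M}_{(i)}=\frac{i!}{(qp^k)^i}\sum_{j=0}^{k-1}\sum_{m=1}^r a_{jm}\frac{\lambda_j^{(i+m)k+i}}{(qp^k)^m}\sum_{b=1}^m\binom{m}{b}\binom{i-1}{b-1}\lambda_j^{-b} =\frac{i!}{(qp^k)^i}\sum_{j=0}^{k-1}\sum_{m=1}^r a_{jm}\frac{m\,\lambda_j^{(i+m)k+i-1}}{(qp^k)^m}\,{}_2F_1(1-m,1-i,2;1/\lambda_j).$$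
   Context: Consider independent Bernoulli trials, indexed $1,2,3,\dots$, with success probability $p$. $\mathrm{NB}(k,r,\ell)$ is the distribution of the index of the trial at which the $r$-th success run of length $k$ is completed, where consecutive counted runs are allowed to overlap in at most $\ell$ trials ($\ell=0$: nonoverlapping, Type I; $\ell=k-1$: Type III). Its probability generating function is $$\sum_{n\ge 0}s^n\,\mathbb{P}(Y=n)=\frac{\phi(s,k)^r}{\phi(s,\ell)^{r-1}},\qquad \phi(s,k)=\frac{p^ks^k(1-ps)}{1-s+qp^ks^{k+1}}$$ (so $\phi(s,0)=1$). It is known that the roots $\lambda_j$ of the auxiliary polynomial are distinct complex numbers with $|\lambda_j|<1$ satisfying $\lambda_j^k(1-\lambda_j)=p^kq$, and that the coefficients $a_{jm}$ exist. Here ${}_2F_1(a,b,c;x)=\sum_{m\ge 0}\frac{a^{\overline m}\,b^{\overline m}}{c^{\overline m}\,m!}x^m$ with $a^{\overline m}=a(a+1)\cdots(a+m-1)$ (all series above terminate). Convention: $\binom{a}{b}=0$ for $b>a\ge 0$. *)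

(* Defs.v *)
From HB Require Import structures.
From mathcomp Require Import all_boot all_order all_algebra.
From mathcomp Require Import complex.
From mathcomp Require Import all_classical all_reals all_analysis.

Set Implicit Arguments.
Unset Strict Implicit.
Unset Printing Implicit Defensive.

Import Order.TTheory GRing.Theory Num.Theory.
Import numFieldNormedType.Exports.
Local Open Scope classical_set_scope.
Local Open Scope ring_scope.

(* Trials are indexed by the positive integers; index 0 is never used. *)

Definition mutually_independent {d d' : measure_display}
    {T : measurableType d} {T' : measurableType d'} {R : realType}
    (P : probability T R) (X : nat -> {RV P >-> T'}) : Prop :=
  forall (s : seq nat) (B : nat -> set T'),
    uniq s -> {in s, forall i, (0 < i)%N} ->
    {in s, forall i, measurable (B i)} ->
    P (\bigcap_(i in [set` s]) (X i @^-1` B i)) =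
    (\prod_(i <- s) P (X i @^-1` B i))%E.

Definition bernoulli_trials {d : measure_display} {T : measurableType d}
    {R : realType} (P : probability T R) (p : R)
    (X : nat -> {RV P >-> bool}) : Prop :=
  mutually_independent X /\
  forall i, (0 < i)%N -> P (X i @^-1` [set true]) = p%:E.

Section Runs.
Variables (k l : nat) (x : nat -> bool).

(* Trials n - k + 1, ..., n exist and are all successes. *)
Definition run_ends_at (n : nat) : bool :=
  (k <= n)%N && all (fun j => x (n - j)%N) (iota 0 k).

(* The indices at most n at which a counted run is completed, latest first.
   A run is counted as soon as it overlaps the previously counted one in at
   most l trials; runs of length k ending at t <= n share k - (n - t) trials
   (truncated subtraction). *)
Fixpoint counted_runs (n : nat) : seq nat :=
  if n is n'.+1 then
    let s := counted_runs n' in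
    if run_ends_at n && (if s is t :: _ then (k - (n - t) <= l)%N else true)
    then n :: s else s
  else [::].

Definition run_completed_at (r n : nat) : bool :=
  (n \in counted_runs n) && (size (counted_runs n) == r).

End Runs.

(* mu is the law NB(k, r, l) with success probability p: the law of the index
   of the trial completing the r-th counted run. *)
Definition negative_binomial {R : realType} (k r l : nat) (p : R)
    (mu : set nat -> \bar R) : Prop :=
  exists (d : measure_display) (T : measurableType d) (P : probability T R)
         (X : nat -> {RV P >-> bool}),
    bernoulli_trials p X /\
    forall n : nat,
      mu [set n] = P [set w | run_completed_at k l (fun i => X i w) r n].

Definition auxiliary_poly {F : fieldType} (k : nat) (p : F) : {poly F} :=
  'X^k - \sum_(j < k) ((1 - p) * p ^+ j) *: 'X^(k - 1 - j).

Definition rising {F : fieldType} (a : F) (m : nat) : F :=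
  \prod_(j < m) (a + j%:R).

Definition hypergeometric2F1 {F : numFieldType} (a b c x : F) : F :=
  limn (series (fun m : nat =>
    rising a m * rising b m / (rising c m * m`!%:R) * x ^+ m)).

(* Main.v *)
Require Import Defs.
From HB Require Import structures.
From mathcomp Require Import all_boot all_order all_algebra.
From mathcomp Require Import complex.
From mathcomp Require Import all_classical all_reals all_analysis.
From mathcomp Require Import measurable_realfun.
From mathcomp Require Import zify ring.

(** The moment is the sum over n of the falling factorial n (n-1) ... (n-i+1)
    times P(Y = n), so the given representation of the law reduces it to a
    linear combination of the series
      sum_n n (n-1) ... (n-i+1) 'C(n-1, m-1) x^(n-m)
    at the roots x of the auxiliary polynomial.  These converge and may be
    summed separately because |x| < 1 (auxiliary_poly_root).

    Each such series has a closed form.  Writing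
      'C(n, i) 'C(n-1, m-1) =
        sum_(1 <= b <= m) 'C(m, b) 'C(i-1, b-1) 'C(n+b-1, i+m-1)
    (bin_mul_Vandermonde) turns it into a combination of shifts of
    sum_n 'C(n, K) x^n = x^K / (1-x)^(K+1) with K = i+m-1 (cvg_sum_bin), whence
      i! x^i / (1-x)^(i+m) sum_b 'C(m, b) 'C(i-1, b-1) x^(-b)
    (cvg_sum_ffact_bin).  A root satisfies x^k (1-x) = q p^k, so that
    1 / (1-x) = x^k / (q p^k) (root_pow_div), and this is the first formula.
    The second one holds because the inner sum over b is a terminating
    hypergeometric series (hypergeometric2F1_bin).

    The series are summed over the complex numbers, whereas the partial sums of
    the moment are real; cvgC_real brings the limit back to the reals, and the
    finiteness of the moment comes with it. *)

Set Implicit Arguments.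
Unset Strict Implicit.
Unset Printing Implicit Defensive.

Import Order.TTheory GRing.Theory Num.Theory.
Import numFieldNormedType.Exports.
Local Open Scope classical_set_scope.
Local Open Scope complex_scope.
Local Open Scope ring_scope.

(** * A convolution identity for binomial coefficients *)

Section BinomialConvolution.
Local Open Scope nat_scope.

(** Both sides count the chains of an m-subset inside a u-subset of an n-set;
    the proof compares factorials. *)
Lemma bin_mul_sub n u m : m <= u -> 'C(n, u) * 'C(u, m) = 'C(n, m) * 'C(n - m, u - m).
Proof.
move=> mu; have [un|nu] := leqP u n; last first.
  rewrite bin_small // mul0n; have [nm|mn] := ltnP n m; first by rewrite bin_small.
  by rewrite [X in _ * X]bin_small ?muln0 //; lia.
(* All four binomial coefficients are in range: clear the denominators. *)
have e1 := bin_fact un; have e2 := bin_fact mu.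
have e3 := bin_fact (leq_trans mu un).
have e4 := bin_fact (leq_sub2r m un).
have ek : n - m - (u - m) = n - u by lia.
rewrite ek in e4.
have f1 := fact_gt0 m; have f2 := fact_gt0 (u - m).
have f3 := fact_gt0 (n - u).
apply/eqP; rewrite -(eqn_pmul2r f1) -(eqn_pmul2r f2) -(eqn_pmul2r f3); apply/eqP.
transitivity n`!.
  by rewrite -e1 -e2; ring.
by rewrite -e3 -e4; ring.
Qed.

(** The product on the left, a polynomial in n of degree i + m + 1, is a
    combination of the shifts of a single binomial coefficient, which is what
    lets one summation formula serve for all products.  Vandermonde's
    convolution is applied to each 'C(n + b.+1, i + m.+1), then to the sum over
    b, and finally, once the factor 'C(n, m) is extracted, to the remaining
    sum, where it restores 'C(n.+1, i.+1). *)
Lemma bin_mul_Vandermonde n i m :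
  'C(n.+1, i.+1) * 'C(n, m) =
  \sum_(b < m.+1) 'C(m.+1, b.+1) * 'C(i, b) * 'C(n + b.+1, i + m.+1).
Proof.
have [nm|mn] := ltnP n m.
  rewrite (bin_small nm) muln0 big1 // => b _.
  have [bi|ib] := leqP b i; last by rewrite (bin_small ib) muln0.
  by rewrite [X in _ * X]bin_small ?muln0 //; have := ltn_ord b; lia.
(* The convolution index t, after the sum over b has been carried out. *)
transitivity (\sum_(t < (i + m.+1).+1) 'C(m.+1, t) * 'C(i + m.+1 - t, m) *
    'C(n, i + m.+1 - t)); last first.
  under [RHS]eq_bigr => b _.
    rewrite [in X in _ * X]addnC -binomial.Vandermonde big_distrr.
    over.
  rewrite exchange_big; apply: eq_bigr => t _ /=.
  under [RHS]eq_bigr do rewrite mulnA.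
  rewrite -big_distrl /=; congr (_ * _).
  have [tm|mt] := leqP t m.+1; last first.
    rewrite bin_small // mul0n big1 // => b _.
    by rewrite ['C(b.+1, t)]bin_small ?muln0 //; have := ltn_ord b; lia.
  rewrite -addnBA // -binomial.Vandermonde big_distrr /=; apply: eq_bigr => b _.
  have bm := ltn_ord b; rewrite mulnAC mulnA.
  have [tb|bt] := leqP t b.+1.
    rewrite (bin_mul_sub _ tb) -(bin_sub (_ : b.+1 - t <= m.+1 - t)); last lia.
    by rewrite mulnAC; congr (_ * 'C(_, _) * _); lia.
  by rewrite (bin_small bt) muln0 mul0n [X in _ * X]bin_small ?muln0 //; lia.
(* The terms with t > i.+1 vanish because then i + m.+1 - t < m. *)
have -> : n.+1 = m.+1 + (n - m) by lia.
rewrite -binomial.Vandermonde big_distrl /= (big_ord_widen (i + m.+1).+1 (fun t =>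
  'C(m.+1, t) * 'C(n - m, i.+1 - t) * 'C(n, m))) ?big_mkcond /=; last lia.
apply: eq_bigr => t _; case: ltnP => ti; last first.
  by have tim := ltn_ord t; rewrite ['C(i + m.+1 - t, m)]bin_small ?muln0 ?mul0n //; lia.
rewrite -!mulnA; congr (_ * _); rewrite [RHS]mulnC bin_mul_sub; last lia.
by rewrite mulnC; congr (_ * 'C(_, _)); lia.
Qed.

End BinomialConvolution.

(** * The series of binomial coefficients times powers *)

(** A bounded series of nonnegative terms converges, so its terms vanish in the
    limit. *)
Lemma cvg0_bounded_series (R : realType) (u : nat -> R) (M : R) :
  (forall n, 0 <= u n) -> (forall n, \sum_(j < n) u j <= M) ->
  u @ \oo --> 0.
Proof.
move=> u0 uM; apply: cvg_series_cvg_0; apply: nondecreasing_is_cvgn.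
  exact: nondecreasing_series.
by exists M => _ [n _ <-]; rewrite /series /= big_mkord.
Qed.

Lemma mulr_sum_bin0 (F : fieldType) (x : F) N :
  (1 - x) * (\sum_(n < N) 'C(n, 0)%:R * x ^+ n) = 1 - x ^+ N.
Proof.
under eq_bigr do rewrite bin0 mul1r.
by rewrite -[1 - x]opprB mulNr -subrX1 opprB.
Qed.

(** Pascal's rule, summed.  The boundary term 'C(N, K.+1) x^N is the only
    obstacle to passing from K to K.+1 in the limit. *)
Lemma mulr_sum_bin (F : fieldType) (x : F) K N :
  (1 - x) * (\sum_(n < N) 'C(n, K.+1)%:R * x ^+ n) =
  x * (\sum_(n < N) 'C(n, K)%:R * x ^+ n) - 'C(N, K.+1)%:R * x ^+ N.
Proof.
elim: N => [|N IHN]; first by rewrite !big_ord0 bin0n !mul0r !mulr0 subr0.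
rewrite !big_ord_recr /= 2!mulrDr IHN binS natrD exprS; ring.
Qed.

(** Dropping the boundary term of the recurrence mulr_sum_bin bounds the
    partial sums for K.+1 in terms of those for K; since the terms are
    nonnegative, boundedness of the sums already forces them to vanish in the
    limit. *)
Lemma cvg_bin_exprn (R : realType) (x : R) K : 0 <= x < 1 ->
  (fun n => 'C(n, K)%:R * x ^+ n) @ \oo --> 0.
Proof.
move=> /andP[x0 x1].
have t0 n j : 0 <= 'C(n, j)%:R * x ^+ n by rewrite mulr_ge0 ?exprn_ge0.
suff [M SM] : exists M, forall N, \sum_(n < N) 'C(n, K)%:R * x ^+ n <= M.
  by apply: cvg0_bounded_series SM => n; exact: t0.
have x1' : 0 < 1 - x by rewrite subr_gt0.
elim: K => [|K [M SM]].
  exists (1 - x)^-1 => N.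
  by rewrite -[leRHS]mul1r ler_pdivlMr // mulrC mulr_sum_bin0 gerBl exprn_ge0.
exists (x * M / (1 - x)) => N.
rewrite ler_pdivlMr // mulrC mulr_sum_bin.
apply: le_trans (ler_wpM2l x0 (SM N)).
by rewrite gerBl t0.
Qed.

(** The expansion of x^K / (1 - x)^(K+1), over any field of numbers in which
    the boundary terms of mulr_sum_bin are known to vanish. *)
Lemma cvg_sum_bin (F : numFieldType) (x : F) K : x != 1 ->
  (forall j, (fun n => 'C(n, j)%:R * x ^+ n) @ \oo --> 0) ->
  (fun N => \sum_(n < N) 'C(n, K)%:R * x ^+ n) @ \oo --> x ^+ K / (1 - x) ^+ K.+1.
Proof.
move=> x1 t0; have x1' : 1 - x != 0 by rewrite subr_eq0 eq_sym.
elim: K => [|K IHK].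
  rewrite [X in X @ _](_ : _ = fun N => (1 - 'C(N, 0)%:R * x ^+ N) / (1 - x)); last first.
    by apply/funext => N; rewrite bin0 mul1r -mulr_sum_bin0 mulrC mulKf.
  rewrite expr0 expr1; apply: cvgMr_tmp; rewrite -[X in _ --> X]subr0.
  by apply: cvgB; [exact: cvg_cst | exact: t0].
rewrite [X in X @ _](_ : _ = fun N =>
    (x * (\sum_(n < N) 'C(n, K)%:R * x ^+ n) - 'C(N, K.+1)%:R * x ^+ N) / (1 - x)).
  rewrite (_ : _ / _ = (x * (x ^+ K / (1 - x) ^+ K.+1) - 0) / (1 - x)).
    by apply: cvgMr_tmp; apply: cvgB; [exact: cvgMl_tmp | exact: t0].
  by rewrite subr0 mulrA -exprS -mulrA -invfM -exprSr.
by apply/funext => N; rewrite -mulr_sum_bin mulrC mulKf.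
Qed.

(** * Factorial-moment series *)

Lemma sum_bin_shift (F : fieldType) (x : F) b K N : (b <= K)%N ->
  \sum_(n < N) 'C(n + b, K)%:R * x ^+ (n + b) =
  \sum_(n < N + b) 'C(n, K)%:R * x ^+ n.
Proof.
move=> bK; rewrite -(big_mkord xpredT (fun n => 'C(n, K)%:R * x ^+ n)).
rewrite (big_cat_nat (n := b)) ?leq_addl //= [X in _ = X + _]big_nat_cond.
rewrite [X in _ = X + _]big1 ?add0r; last first.
  by move=> n /andP[/andP[_ nb] _]; rewrite bin_small ?mul0r // (leq_trans nb).
by rewrite -[in RHS](add0n b) big_addn add0n addnK big_mkord.
Qed.

(** The generating-function core of the theorem: by bin_mul_Vandermonde, the
    factorial-moment series of one term 'C(n - 1, m) x^(n - m - 1) splits into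
    finitely many shifted copies of the series of cvg_sum_bin. *)
Lemma cvg_sum_ffact_bin (F : numFieldType) (x : F) i m : x != 0 -> x != 1 ->
  (forall j, (fun n => 'C(n, j)%:R * x ^+ n) @ \oo --> 0) ->
  (fun N => \sum_(n < N) (n ^_ i.+1)%:R *
     ('C(n - 1, m)%:R * x ^ (n%:Z - m.+1%:Z))) @ \oo -->
  i.+1`!%:R * (x ^+ i.+1 / (1 - x) ^+ (i.+1 + m.+1)) *
  \sum_(b < m.+1) 'C(m.+1, b.+1)%:R * 'C(i, b)%:R * x ^- b.+1.
Proof.
move=> x0 x1 tails.
pose K := (i + m.+1)%N.
pose w (b : 'I_m.+1) : F := i.+1`!%:R * ('C(m.+1, b.+1) * 'C(i, b))%:R / x ^+ (b + m.+1).
have termE (n : nat) : (n ^_ i.+1)%:R * ('C(n - 1, m)%:R * x ^ (n%:Z - m.+1%:Z)) =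
    \sum_(b < m.+1) w b * ('C(n + b, K)%:R * x ^+ (n + b)).
  have binE : ('C(n, i.+1) * 'C(n - 1, m) =
      \sum_(b < m.+1) 'C(m.+1, b.+1) * 'C(i, b) * 'C(n + b, K))%N.
    (* At n = 0 the truncated n - 1 is harmless: both sides are 0. *)
    case: n => [|n]; last first.
      rewrite subn1 /= bin_mul_Vandermonde; apply: eq_bigr => b _.
      by rewrite addSnnS.
    rewrite bin0n mul0n big1 // => b _; rewrite [X in (_ * X)%N]bin_small ?muln0 //.
    by rewrite /K; have := ltn_ord b; lia.
  rewrite -bin_ffact mulrA -natrM mulnAC binE natrM natr_sum !mulr_suml.
  apply: eq_bigr => b _; rewrite /w.
  have -> : x ^ (n%:Z - m.+1%:Z) = x ^+ n / x ^+ m.+1.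
    by rewrite expfzDr // exprnN.
  rewrite !natrM [x ^+ (n + b)]exprD [x ^+ (b + m.+1)]exprD; field.
  by rewrite !expf_neq0.
rewrite [X in X @ _](_ : _ = fun N => \sum_(b < m.+1) w b *
    \sum_(n < N + b) 'C(n, K)%:R * x ^+ n); last first.
  apply/funext => N; under eq_bigr do rewrite termE.
  rewrite exchange_big; apply: eq_bigr => b _ /=.
  by rewrite -mulr_sumr sum_bin_shift // /K; have := ltn_ord b; lia.
rewrite mulr_sumr; apply: cvg_big => [|b _]; first exact: add_continuous.
rewrite (_ : _ * _ = w b * (x ^+ K / (1 - x) ^+ K.+1)).
  apply: cvgMl_tmp.
  by by have := cvg_sum_bin (K := K) x1 tails; rewrite -(cvg_shiftn b).
rewrite /w /K natrM !(exprD, exprS).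
by field; rewrite ?expf_neq0 ?x0 ?subr_eq0 // eq_sym x1.
Qed.

(** * The hypergeometric factor *)

(** For b > n both sides vanish, which is why the hypergeometric series below
    is a finite sum. *)
Lemma rising_oppn (F : fieldType) n b :
  rising (1 - n.+1%:R : F) b = (-1) ^+ b * (n ^_ b)%:R.
Proof.
rewrite /rising; elim: b => [|b IHb]; first by rewrite big_ord0 mul1r.
rewrite big_ord_recr /= IHb exprS ffactnSr natrM.
have [bn|nb] := leqP b n; last by rewrite ffact_small // !(mulr0, mul0r).
by rewrite natrB // -addn1 natrD; ring.
Qed.

Lemma rising2 (F : fieldType) b : rising (2 : F) b = b.+1`!%:R.
Proof.
rewrite /rising; elim: b => [|b IHb]; first by rewrite big_ord0.
by rewrite big_ord_recr /= IHb [in RHS]factS natrM mulrC -natrD add2n.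
Qed.

(** The signs of the two rising factorials with nonpositive parameters cancel,
    and dividing the two falling factorials they leave by b.+1`! and b`! turns
    them into binomial coefficients. *)
Lemma hypergeometric2F1_bin (F : numFieldType) m i (y : F) :
  m.+1%:R * hypergeometric2F1 (1 - m.+1%:R) (1 - i.+1%:R) 2 y =
  \sum_(b < m.+1) 'C(m.+1, b.+1)%:R * 'C(i, b)%:R * y ^+ b.
Proof.
rewrite /hypergeometric2F1.
set u := (X in series X).
have u0 b : (m < b)%N -> u b = 0.
  by move=> mb; rewrite /u rising_oppn ffact_small // mulr0 !mul0r.
rewrite (_ : limn _ = \sum_(b < m.+1) u b); last first.
  apply: lim_near_cst; first exact: norm_hausdorff.
  near=> N; rewrite /series /= (big_cat_nat (n := m.+1)) //=; last first.
    by near: N; exists m.+1.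
  rewrite [X in _ + X]big_nat [X in _ + X]big1 ?addr0 ?big_mkord // => b /andP[mb _].
  exact: u0.
rewrite mulr_sumr; apply: eq_bigr => b _.
rewrite /u !rising_oppn rising2 mulrA; congr (_ * _).
have fact_neq0 n : n`!%:R != 0 :> F by rewrite pnatr_eq0 -lt0n fact_gt0.
have e1 : 'C(m.+1, b.+1)%:R * b.+1`!%:R = m.+1%:R * (m ^_ b)%:R :> F.
  by rewrite -!natrM bin_ffact ffactSS.
have e2 : 'C(i, b)%:R * b`!%:R = (i ^_ b)%:R :> F by rewrite -natrM bin_ffact.
apply: (mulIf (fact_neq0 b.+1)); apply: (mulIf (fact_neq0 b)).
rewrite [RHS](_ : _ = ('C(m.+1, b.+1)%:R * b.+1`!%:R) *
  ('C(i, b)%:R * b`!%:R)); last by ring.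
rewrite e1 e2.
have s1 : (-1) ^+ b * (-1) ^+ b = 1 :> F by rewrite -exprMn mulrNN mulr1 expr1n.
transitivity ((-1) ^+ b * (-1) ^+ b * (m.+1%:R * (m ^_ b)%:R * (i ^_ b)%:R) : F);
  last by rewrite s1 mul1r.
field.
by rewrite !fact_neq0.
Unshelve. all: by end_near. Qed.

(** * Roots of the auxiliary polynomial *)

(** Multiplying the auxiliary polynomial by z - p telescopes it to
    z^(k+1) - z^k + (1 - p) p^k.  For the bound, 1 <= |z| would give
    |z|^k <= |z|^(k-1) (1 - p) (1 + p + ... + p^(k-1)) = |z|^(k-1) (1 - p^k),
    which is smaller than |z|^k. *)
Lemma auxiliary_poly_root (F : numFieldType) k (p z : F) : (0 < k)%N ->
  0 < p < 1 -> root (auxiliary_poly k p) z ->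
  z ^+ k * (1 - z) = (1 - p) * p ^+ k /\ `|z| < 1.
Proof.
move=> k0 /andP[p0 p1] /rootP.
rewrite /auxiliary_poly hornerD hornerN horner_sum hornerXn.
under eq_bigr do rewrite hornerZ hornerXn.
move/eqP; rewrite subr_eq0 => /eqP zk.
split.
  have h : (z - p) * z ^+ k = (1 - p) * (z ^+ k - p ^+ k).
    rewrite {1}zk subrXX mulrCA; congr (_ * _); rewrite !mulr_sumr; apply: eq_bigr => j _.
    by rewrite subn1; ring.
  apply: subr0_eq.
  transitivity ((1 - p) * (z ^+ k - p ^+ k) - (z - p) * z ^+ k); first by ring.
  by rewrite h subrr.
have q0 : 0 <= 1 - p by rewrite subr_ge0 ltW.
rewrite real_ltNge ?normr_real ?real1 //; apply/negP => z1.
have : `|z| ^+ k < `|z| ^+ k.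
  rewrite -{1}normrX zk; apply: le_lt_trans (ler_norm_sum _ _ _) _.
  apply: (@le_lt_trans _ _ (\sum_(j < k) (1 - p) * p ^+ j * `|z| ^+ k.-1)).
    apply: ler_sum => j _; rewrite !normrM normrX (ger0_norm q0) normrX (gtr0_norm p0).
    rewrite ler_wpM2l ?mulr_ge0 ?exprn_ge0 ?(ltW p0) //.
    by apply: ler_weXn2l => //; rewrite -subn1 leq_subr.
  rewrite -mulr_suml -mulr_sumr -opprB mulNr -subrX1 opprB.
  rewrite -[X in _ < _ ^+ X](prednK k0) exprS ltr_pM2r ?exprn_gt0 ?(lt_le_trans ltr01) //.
  by apply: lt_le_trans z1; rewrite gtrBl exprn_gt0.
by rewrite ltxx.
Qed.

(** At a root of x^k (1 - x) = y, the poles 1 / (1 - x) are traded for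
    x^k / y; this is where the exponents (i + m) k of the moment formula come
    from. *)
Lemma root_pow_div (F : fieldType) (x y : F) k i m : x ^+ k * (1 - x) = y -> y != 0 ->
  x ^+ i / (1 - x) ^+ (i + m) = x ^+ ((i + m) * k + i) / (y ^+ i * y ^+ m).
Proof.
move=> xy y0; have : x ^+ k * (1 - x) != 0 by rewrite xy.
rewrite mulf_eq0 negb_or => /andP[xk0 x1].
rewrite -xy -exprD exprMn [x ^+ (_ + i)]exprD mulnC exprM.
by field; apply/andP; split; exact: expf_neq0.
Qed.

(** * Limits of complex sequences *)

(** The ascriptions to numFieldType make the norm topology of the complex
    numbers visible. *)
Lemma cvgC_squeeze (R : realType) (u : nat -> (R[i] : numFieldType))
    (l : (R[i] : numFieldType)) (v : nat -> R) :
  (forall n, `|l - u n| <= (v n)%:C) -> v @ \oo --> 0 -> u @ \oo --> l.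
Proof.
move=> uv /cvgr0Pnorm_lt v0; apply/cvgrPdist_lt => -[e e'].
rewrite ltcE /= => /andP[/eqP -> e0].
near=> n; apply: le_lt_trans (uv n) _; rewrite ltcR.
by apply: le_lt_trans (ler_norm _) _; near: n; exact: v0.
Unshelve. all: by end_near. Qed.

(** The real line is closed in the complex plane. *)
Lemma cvgC_real (R : realType) (s : nat -> R) (l : (R[i] : numFieldType)) :
  (fun n => (s n)%:C : (R[i] : numFieldType)) @ \oo --> l ->
  s @ \oo --> complex.Re l /\ l = (complex.Re l)%:C.
Proof.
move=> sl.
have sRe : s @ \oo --> complex.Re l.
  apply/cvgrPdist_lt => e e0; move/cvgrPdist_lt : sl => /(_ e%:C).
  rewrite ltcR => /(_ e0) sl; near=> n.
  rewrite -ltcR; apply: le_lt_trans (_ : `|l - (s n)%:C| < _); last by near: n.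
  by apply: le_trans (normc_ge_Re _); case: (l).
split; first exact: sRe.
apply: (@cvg_unique _ (@norm_hausdorff _ (R[i] : numFieldType)) _ _ _ _ sl).
apply: (@cvgC_squeeze _ _ _ (fun n => `|complex.Re l - s n|)).
  by move=> n; rewrite -rmorphB normc_def /= expr0n addr0 sqrtr_sqr.
rewrite -(normr0 R) -(subrr (complex.Re l)); apply: cvg_norm.
by apply: cvgB; [exact: cvg_cst | exact: sRe].
Unshelve. all: by end_near. Qed.

Lemma cvgC_bin_exprn (R : realType) (z : (R[i] : numFieldType)) K : `|z| < 1 ->
  (fun n => 'C(n, K)%:R * z ^+ n) @ \oo --> 0.
Proof.
move=> z1; have : 0 <= `|z| by [].
move: z1; have [x zx] : exists x : R, `|z| = x%:C by eexists; exact: normc_def.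
rewrite zx ltcR lecR => x1 x0.
apply: (@cvgC_squeeze _ _ _ (fun n => 'C(n, K)%:R * x ^+ n)).
  move=> n; rewrite sub0r normrN normrM normrX normr_nat zx.
  by rewrite rmorphM rmorphXn rmorph_nat.
by apply: cvg_bin_exprn; rewrite x0.
Qed.

(** * Expectation of a function of an integer random variable *)

Lemma expectation_nat d (T : measurableType d) (R : realType)
    (P : probability T R) (Y : {RV P >-> nat}) (f : nat -> R) :
  (forall n, 0 <= f n) ->
  ('E_P[(fun w => f (Y w))] =
   \big[+%E/0%E]_(0 <= n <oo) ((f n)%:E * P (Y @^-1` [set n])))%E.
Proof.
move=> f0; rewrite unlock.
have mY n : measurable (Y @^-1` [set n]).
  by rewrite -[X in measurable X]setTI; exact: measurable_funP.
have cover : [set: T] = \bigcup_n (Y @^-1` [set n]).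
  by apply/esym; rewrite -subTset => w _; exists (Y w).
rewrite cover ge0_integral_bigcup //=; last first.
- apply/trivIsetP => m n _ _ mn; rewrite -preimage_setI.
  by rewrite -subset0 => w [/= -> /eqP]; rewrite (negPf mn).
- by move=> w _; rewrite lee_fin.
- rewrite -cover; apply/measurable_EFinP.
  by apply: (measurableT_comp (f := f) (g := Y)).
apply: eq_eseriesr => n _.
under eq_integral => w /set_mem /= -> do over.
by rewrite integral_cst.
Qed.

Lemma expectation_nat_cvg d (T : measurableType d) (R : realType)
    (P : probability T R) (Y : {RV P >-> nat}) (f : nat -> R) (L : R) :
  (forall n, 0 <= f n) ->
  (fun N => \sum_(n < N) f n * fine (P (Y @^-1` [set nat_of_ord n]))) @ \oo --> L ->
  ('E_P[(fun w => f (Y w))] = L%:E)%E.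
Proof.
move=> f0 fL; rewrite expectation_nat //; apply: cvg_lim => //.
rewrite [X in X @ _](_ : _ = EFin \o
    fun N => \sum_(n < N) f n * fine (P (Y @^-1` [set nat_of_ord n]))).
  by apply/fine_cvgP; split; [exact: nearW | exact: fL].
apply/funext => N /=; rewrite big_mkord -sumEFin; apply: eq_bigr => n _.
have mY : measurable (Y @^-1` [set nat_of_ord n]).
  by rewrite -[X in measurable X]setTI; exact: measurable_funP.
by rewrite EFinM fineK ?fin_num_measure.
Qed.

(** * Factorial moments *)

Theorem mainTheorem7 (R : realType) (k r l : nat) (p : R)
    (hk : (1 <= k)%N) (hr : (1 <= r)%N) (hl : (l <= k - 1)%N)
    (hp : 0 < p < 1)
    (d : measure_display) (T : measurableType d) (P : probability T R)
    (Y : {RV P >-> nat}) (hY : negative_binomial k r l p (distribution P Y))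
    (lambda : 'I_k -> R[i])
    (hlambda : auxiliary_poly k p%:C = \prod_(j < k) ('X - (lambda j)%:P))
    (a : 'I_k -> nat -> R[i])
    (ha : forall n : nat, (1 <= n)%N ->
       (fine (P (Y @^-1` [set n])))%:C =
       \sum_(j < k) \sum_(1 <= m < r.+1)
          'C(n - 1, m - 1)%:R * a j m * lambda j ^ (n%:Z - m%:Z))
    (i : nat) (hi : (1 <= i)%N) :
  let q : R := 1 - p in
  let c : R[i] := (q * p ^+ k)%:C in
  let M := ('E_P[(fun w => (Y w ^_ i)%:R)])%E in
  [/\ (M \is a fin_num),
      (fine M)%:C =
        i`!%:R / c ^+ i *
        \sum_(j < k) \sum_(1 <= m < r.+1)
          a j m * (lambda j ^+ ((i + m) * k + i) / c ^+ m) *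
          \sum_(1 <= b < m.+1)
            'C(m, b)%:R * 'C(i - 1, b - 1)%:R * lambda j ^- b
    & (fine M)%:C =
        i`!%:R / c ^+ i *
        \sum_(j < k) \sum_(1 <= m < r.+1)
          a j m * (m%:R * lambda j ^+ ((i + m) * k + i - 1) / c ^+ m) *
          hypergeometric2F1 (1 - m%:R) (1 - i%:R) 2 (lambda j)^-1 ].
Proof.
move=> q c M.
case: i hi @M => // i _ M.
have [p0 p1] := andP hp.
have c0 : c != 0.
  by rewrite fmorph_eq0 mulf_neq0 ?expf_neq0 ?gt_eqF // subr_gt0.
have root_lambda j : lambda j ^+ k * (1 - lambda j) = c /\ `|lambda j| < 1.
  rewrite /c rmorphM rmorphB rmorphXn rmorph1.
  apply: auxiliary_poly_root => //; first by rewrite !ltcR.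
  rewrite hlambda; apply/rootP; rewrite horner_prod.
  by apply/eqP/prodf_eq0; exists j => //; rewrite !hornerE subrr.
have lambda0 j : lambda j != 0.
  apply: contraNneq c0 => lj; have [<- _] := root_lambda j.
  by rewrite lj expr0n gtn_eqF // mul0r.
have lambda1 j : lambda j != 1.
  apply: contraNneq c0 => lj; have [<- _] := root_lambda j.
  by rewrite lj subrr mulr0.
(* The common value of the two formulas, with m and b counted from 0. *)
pose L : R[i] := i.+1`!%:R / c ^+ i.+1 *
  \sum_(j < k) \sum_(m < r)
    a j m.+1 * (lambda j ^+ ((i.+1 + m.+1) * k + i.+1) / c ^+ m.+1) *
    \sum_(b < m.+1) 'C(m.+1, b.+1)%:R * 'C(i, b)%:R * lambda j ^- b.+1.
pose S N : R := \sum_(n < N) (n ^_ i.+1)%:R * fine (P (Y @^-1` [set nat_of_ord n])).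
have cvgS : (fun N => (S N)%:C : (R[i] : numFieldType)) @ \oo -->
    (L : (R[i] : numFieldType)).
  rewrite [X in X @ _](_ : _ = fun N => \sum_(j < k) \sum_(m < r) a j m.+1 *
      \sum_(n < N) (n ^_ i.+1)%:R *
        ('C(n - 1, m)%:R * lambda j ^ (n%:Z - m.+1%:Z))); last first.
    apply/funext => N; rewrite rmorph_sum.
    under [RHS]eq_bigr => j _.
      under eq_bigr do rewrite mulr_sumr.
      rewrite exchange_big.
      over.
    rewrite exchange_big; apply: eq_bigr => n _.
    (* The representation of the law starts at n = 1; the term n = 0 carries
       the factor 0 ^_ i.+1 = 0. *)
    rewrite rmorphM rmorph_nat /=; case: (posnP n) => [->|n0].
      by rewrite mul0r big1 // => j _; rewrite big1 // => m _; rewrite mul0r mulr0.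
    rewrite ha // mulr_sumr; apply: eq_bigr => j _.
    rewrite big_add1 big_mkord mulr_sumr; apply: eq_bigr => m _.
    by rewrite [(m.+1 - 1)%N]subn1 [m.+1.-1]/=; ring.
  rewrite /L mulr_sumr; apply: cvg_big => [|j _]; first exact: add_continuous.
  rewrite mulr_sumr; apply: cvg_big => [|m _]; first exact: add_continuous.
  have [lc l1] := root_lambda j.
  rewrite [X in _ --> X](_ : _ = a j m.+1 * (i.+1`!%:R *
      (lambda j ^+ i.+1 / (1 - lambda j) ^+ (i.+1 + m.+1)) *
      \sum_(b < m.+1) 'C(m.+1, b.+1)%:R * 'C(i, b)%:R * lambda j ^- b.+1)).
    apply: (@cvgMl_tmp (R[i] : numFieldType)). apply: cvg_sum_ffact_bin => // n. 
    exact: cvgC_bin_exprn.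
  by rewrite (root_pow_div _ _ lc c0); field; rewrite !expf_neq0.
have [SL LE] := cvgC_real cvgS.
have ME : M = (complex.Re L)%:E.
  by apply: (expectation_nat_cvg (f := fun n => (n ^_ i.+1)%:R)) => // n.
have fineM : (fine M)%:C = L by rewrite ME LE.
split; first by rewrite ME.
- rewrite fineM /L; congr (_ * _); apply: eq_bigr => j _.
  rewrite big_add1 big_mkord; apply: eq_bigr => m _; congr (_ * _).
  rewrite big_add1 big_mkord; apply: eq_bigr => b _.
  by rewrite !subn1.
- rewrite fineM /L; congr (_ * _); apply: eq_bigr => j _.
  rewrite big_add1 big_mkord; apply: eq_bigr => m _.
  rewrite addnS subn1 /= [lambda j ^+ (_ + i).+1]exprS.
  rewrite [RHS](_ : _ = a j m.+1 * (lambda j ^+ ((i.+1 + m.+1) * k + i) / c ^+ m.+1) *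
    (m.+1%:R * hypergeometric2F1 (1 - m.+1%:R) (1 - i.+1%:R) 2 (lambda j)^-1)); last first.
    by ring.
  rewrite hypergeometric2F1_bin !mulr_sumr; apply: eq_bigr => b _.
  by rewrite exprVn [lambda j ^+ b.+1]exprS; field; rewrite ?(lambda0, expf_neq0).
Qed.
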